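(* Let $n\ge1$. The map $p^*:N\to M$ given in the context is unimodular (an isomorphism of lattices), so in the initial seed $\Xi\subset M_{\mathbb R}$ is unimodularly equivalent to the Knutson–Tao hive cone in $N_{\mathbb R}$ (i.e. some isomorphism of lattices $N\to M$ carries the hive cone onto $\Xi$).
   Context: $\mathcal H=\{(a,b,c)\in\mathbb Z_{\ge0}^3:a+b+c=n\}$; $e_i$ and $e_i^*$ ($i\in\mathcal H$) are the standard and dual bases of $\mathbb Z^{\mathcal H}$; $\mathbf 1$ is the all-ones vector; $N=\mathbb Z^{\mathcal H}/\mathbb Z\mathbf 1$, $M=\mathrm{Hom}(N,\mathbb Z)=\{m\in\mathbb Z^{\mathcal H}:\sum m_i=0\}$. **The map $p^*$.** It is induced by the following map on $\mathbb Z^{\mathcal H}$, which kills $\mathbf 1$ and has image in $M$. For $a,b,c>0$: $p^*(e_{(a,b,c)})=e^*_{(a-1,b+1,c)}+e^*_{(a,b-1,c+1)}+e^*_{(a+1,b,c-1)}-e^*_{(a+1,b-1,c)}-e^*_{(a,b+1,c-1)}-e^*_{(a-1,b,c+1)}$. For edges (the two displayed entries positive): $p^*(e_{(a,b,0)})=e^*_{(a,b,0)}-e^*_{(a-1,b,1)}+e^*_{(a,b-1,1)}-e^*_{(a+1,b-1,0)}$; $p^*(e_{(0,b,c)})=e^*_{(0,b,c)}-e^*_{(1,b-1,c)}+e^*_{(1,b,c-1)}-e^*_{(0,b+1,c-1)}$; $p^*(e_{(a,0,c)})=e^*_{(a,0,c)}-e^*_{(a,1,c-1)}+e^*_{(a-1,1,c)}-e^*_{(a-1,0,c+1)}$.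 For corners: $p^*(e_{(n,0,0)})=e^*_{(n,0,0)}-e^*_{(n-1,0,1)}$, $p^*(e_{(0,n,0)})=e^*_{(0,n,0)}-e^*_{(1,n-1,0)}$, $p^*(e_{(0,0,n)})=e^*_{(0,0,n)}-e^*_{(0,1,n-1)}$. **Cone $\Xi$ in the initial seed.** The set of $g\in M_{\mathbb R}$ such that, for positive integers, $\sum_{j=0}^ig_{(a,b-j,j)}\ge0$ ($a+b=n$, $0\le i\le b-1$), $\sum_{j=0}^ig_{(j,b,c-j)}\ge0$ ($b+c=n$, $0\le i\le c-1$), $\sum_{j=0}^ig_{(a-j,j,c)}\ge0$ ($a+c=n$, $0\le i\le a-1$). **Knutson–Tao hive cone.** View $\mathcal H$ as the vertices of a triangle subdivided into unit triangles (two vertices adjacent if they differ by a permutation of $(1,-1,0)$). Two unit triangles sharing an edge form a rhombus; the endpoints of the shared edge are the obtuse vertices, the other two the acute vertices. The hive cone is the image in $N_{\mathbb R}=\mathbb R^{\mathcal H}/\mathbb R\mathbf 1$ of the set of real labelings of $\mathcal H$ such that, for every rhombus, the sum of the labels at the obtuse vertices is at least the sum at the acute vertices. *)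

(* Defs.v *)
From HB Require Import structures.
From mathcomp Require Import all_boot all_order all_algebra.
From mathcomp Require Import zify ring.
From mathcomp Require Import boolp classical_sets reals.

Set Implicit Arguments.
Unset Strict Implicit.
Unset Printing Implicit Defensive.

Import Order.TTheory GRing.Theory Num.Theory.
Local Open Scope ring_scope.
Local Open Scope quotient_scope.

Definition vtx (n : nat) :=
  {t : 'I_n.+1 * 'I_n.+1 * 'I_n.+1 | (t.1.1 + t.1.2 + t.2 == n)%N}.

HB.instance Definition _ n := Finite.on (vtx n).

Definition coords n (t : vtx n) : nat * nat * nat :=
  ((val t).1.1 : nat, (val t).1.2 : nat, (val t).2 : nat).

Arguments coords : simpl never.

(* A^o is A as a module over itself, which makes vec A n an A-module. *)
Notation vec A n := {ffun vtx n -> A^o}.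

(* Standard and dual basis vectors are both written in A^(vtx n); this is 0
   when a + b + c <> n. *)
Definition bvec (A : comNzRingType) n (a b c : nat) : vec A n :=
  [ffun t => (coords t == (a, b, c))%:R].

(* The entry of x at (a, b, c), and 0 when a + b + c <> n. *)
Definition entry (A : comNzRingType) n (x : vec A n) (a b c : nat) : A :=
  \sum_(t : vtx n | coords t == (a, b, c)) x t.

Section Lattices.
Variables (A : comNzRingType) (n : nat).

(* The line A 1; see const_lineP. *)
Definition const_line : {pred vec A n} :=
  [pred x : vec A n | [forall s, forall t, x s == x t]].

Lemma const_lineE (x : vec A n) :
  reflect (forall s t, x s = x t) (x \in const_line).
Proof.
apply: (iffP forallP) => [h s t|h s]; first by have /forallP/(_ t)/eqP := h s.
by apply/forallP => t; rewrite (h s t).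
Qed.

Lemma corner_subproof :
  (let t := (@ord_max n, @ord0 n, @ord0 n) in t.1.1 + t.1.2 + t.2 == n)%N.
Proof. by rewrite /= !addn0. Qed.

Definition corner : vtx n := Sub (@ord_max n, @ord0 n, @ord0 n) corner_subproof.

Lemma const_lineP (x : vec A n) :
  reflect (exists c : A, x = c *: [ffun=> 1]) (x \in const_line).
Proof.
apply: (iffP (const_lineE x)) => [h|[c -> s t]]; last by rewrite !ffunE.
by exists (x corner); apply/ffunP => t; rewrite !ffunE (h t corner) [RHS]mulr1.
Qed.

Lemma const_line_zmod_closed : zmod_closed const_line.
Proof.
split; first by apply/const_lineE => s t; rewrite !ffunE.
move=> x y /const_lineE hx /const_lineE hy; apply/const_lineE => s t.
by rewrite !ffunE (hx s t) (hy s t).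
Qed.

HB.instance Definition _ :=
  GRing.isZmodClosed.Build (vec A n) const_line const_line_zmod_closed.

Lemma const_lineZ (a : A) (x : vec A n) :
  x \in const_line -> a *: x \in const_line.
Proof.
by move=> /const_lineE h; apply/const_lineE => s t; rewrite !ffunE (h s t).
Qed.

(* The lattice N is N int n, and N_R is N R n; likewise for M below. *)
Definition N := Quotient.quot const_line.

HB.instance Definition _ := Choice.on N.
HB.instance Definition _ := GRing.Zmodule.on N.
HB.instance Definition _ := @ZmodQuotient.on N.

Definition Ncls (x : vec A n) : N := \pi_N x.

Lemma reprNK (u : N) : Ncls (repr u) = u.
Proof. exact: reprK. Qed.

Lemma Ncls_eq x y : (Ncls x == Ncls y) = (x - y \in const_line).
Proof. exact/esym/Quotient.idealrBE. Qed.

Lemma NclsD x y : Ncls (x + y) = Ncls x + Ncls y.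
Proof. exact: raddfD. Qed.

Definition Nscale (a : A) (u : N) : N := Ncls (a *: repr u).

Lemma NclsZ_subproof a x : Ncls (a *: x) = Nscale a (Ncls x).
Proof.
by apply/eqP; rewrite Ncls_eq -scalerBr const_lineZ // -Ncls_eq reprNK.
Qed.

Lemma NscaleA a b u : Nscale a (Nscale b u) = Nscale (a * b) u.
Proof. by rewrite -[u]reprNK -!NclsZ_subproof scalerA. Qed.

Lemma Nscale1 : left_id 1 Nscale.
Proof. by move=> u; rewrite -[u]reprNK -NclsZ_subproof scale1r. Qed.

Lemma NscaleDr : right_distributive Nscale +%R.
Proof.
move=> a u v; rewrite -[u]reprNK -[v]reprNK -NclsD -!NclsZ_subproof -NclsD.
by rewrite scalerDr.
Qed.

Lemma NscaleDl u : {morph Nscale^~ u : a b / a + b}.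
Proof.
by move=> a b; rewrite -[u]reprNK -!NclsZ_subproof -NclsD scalerDl.
Qed.

HB.instance Definition _ := GRing.Zmodule_isLmodule.Build A N
  NscaleA Nscale1 NscaleDr NscaleDl.

Lemma Ncls_is_linear : linear Ncls.
Proof. by move=> a x y; rewrite NclsD NclsZ_subproof. Qed.

HB.instance Definition _ :=
  GRing.isLinear.Build A (vec A n) N _ Ncls Ncls_is_linear.

(* M is Hom(N, A): by the pairing with A^(vtx n), the functionals on N are the
   vectors of entry sum 0. *)
Definition sum_zero : {pred vec A n} := [pred x : vec A n | \sum_t x t == 0].

Lemma sum_zero_submod_closed : submod_closed sum_zero.
Proof.
split; first by apply/eqP; rewrite big1 // => t _; rewrite ffunE.
move=> a x y /eqP hx /eqP hy; apply/eqP.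
under eq_bigr do rewrite !ffunE.
by rewrite big_split /= -scaler_sumr hx hy scaler0 addr0.
Qed.

HB.instance Definition _ :=
  GRing.isSubmodClosed.Build A (vec A n) sum_zero sum_zero_submod_closed.

Record M := MkM { Mval :> vec A n; MvalP : Mval \in sum_zero }.

HB.instance Definition _ := [isSub for Mval].
HB.instance Definition _ := [Choice of M by <:].
HB.instance Definition _ := [SubChoice_isSubLmodule of M by <:].

Local Notation e := (@bvec A n).

(* The last branch only occurs for n = 0. *)
Definition pstar_basis (a b c : nat) : vec A n :=
  match (0 < a)%N, (0 < b)%N, (0 < c)%N with
  | true, true, true =>
      e (a - 1) (b + 1) c + e a (b - 1) (c + 1) + e (a + 1) b (c - 1)
      - e (a + 1) (b - 1) c - e a (b + 1) (c - 1) - e (a - 1) b (c + 1)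
  | true, true, false =>
      e a b 0 - e (a - 1) b 1 + e a (b - 1) 1 - e (a + 1) (b - 1) 0
  | false, true, true =>
      e 0 b c - e 1 (b - 1) c + e 1 b (c - 1) - e 0 (b + 1) (c - 1)
  | true, false, true =>
      e a 0 c - e a 1 (c - 1) + e (a - 1) 1 c - e (a - 1) 0 (c + 1)
  | true, false, false => e a 0 0 - e (a - 1) 0 1
  | false, true, false => e 0 b 0 - e 1 (b - 1) 0
  | false, false, true => e 0 0 c - e 0 1 (c - 1)
  | false, false, false => 0
  end.

Definition pstar_vec (x : vec A n) : vec A n :=
  \sum_t x t *: pstar_basis (coords t).1.1 (coords t).1.2 (coords t).2.

Lemma coords_inj : injective (@coords n).
Proof.
move=> [[[a b] c] hs] [[[a' b'] c'] ht] [/val_inj/= ea /val_inj/= eb].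
by move=> /val_inj/= ec; apply/val_inj; rewrite /= ea eb ec.
Qed.

Lemma coords_sum (t : vtx n) :
  ((coords t).1.1 + (coords t).1.2 + (coords t).2)%N = n.
Proof. exact/eqP/(valP t). Qed.

Lemma coords_exist a b c : (a + b + c)%N = n ->
  exists t : vtx n, coords t = (a, b, c).
Proof.
move=> e; have [ha hb hc] : [/\ a < n.+1, b < n.+1 & c < n.+1]%N by split; lia.
have ht : (let t := (Ordinal ha, Ordinal hb, Ordinal hc) in
           t.1.1 + t.1.2 + t.2 == n)%N by apply/eqP.
by exists (Sub (Ordinal ha, Ordinal hb, Ordinal hc) ht).
Qed.

Lemma sum_bvec a b c : (a + b + c)%N = n ->
  \sum_t (bvec A n a b c t : A) = 1.
Proof.
move=> /coords_exist[t et]; rewrite (bigD1 t) //= ffunE et eqxx.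
rewrite big1 ?addr0 // => s st; rewrite ffunE -et.
by rewrite (inj_eq coords_inj) (negPf st).
Qed.


(* Uniform form of pstar_basis, used to show that pstar_vec kills 1. *)
Definition pstar_aux (a b c : nat) : vec A n :=
  (if (0 < a)%N && (0 < c)%N then e (a - 1) (b + 1) c else 0)
  + (if (0 < a)%N && (c == 0)%N then e a b c else 0)
  - (if (0 < a)%N then e (a - 1) b (c + 1) else 0)
  + (if (0 < b)%N && (0 < a)%N then e a (b - 1) (c + 1) else 0)
  + (if (0 < b)%N && (a == 0)%N then e a b c else 0)
  - (if (0 < b)%N then e (a + 1) (b - 1) c else 0)
  + (if (0 < c)%N && (0 < b)%N then e (a + 1) b (c - 1) else 0)
  + (if (0 < c)%N && (b == 0)%N then e a b c else 0)
  - (if (0 < c)%N then e a (b + 1) (c - 1) else 0).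

Lemma pstar_auxE a b c : pstar_basis a b c = pstar_aux a b c.
Proof.
rewrite /pstar_basis /pstar_aux.
by case: a b c => [|a] [|b] [|c] /=; rewrite ?add0n; apply/ffunP => t;
  rewrite !ffunE; ring.
Qed.

Local Notation T3 := (nat * nat * nat)%type.
Local Notation sum3 x := (x.1.1 + x.1.2 + x.2)%N.

Lemma sum_shift (P Q : pred T3) (f g : T3 -> T3) :
    (forall x, sum3 x = n -> P x -> Q (f x) /\ g (f x) = x) ->
    (forall x, sum3 x = n -> Q x ->
       [/\ P (g x), f (g x) = x & sum3 (g x) = n]) ->
  \sum_(t : vtx n) (if P (coords t)
      then e (f (coords t)).1.1 (f (coords t)).1.2 (f (coords t)).2 else 0)
  = [ffun s => (Q (coords s))%:R].
Proof.
move=> hP hQ; apply/ffunP => s; rewrite sum_ffunE ffunE.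
have h0 (t : vtx n) : P (coords t) -> coords s = f (coords t) ->
    Q (coords s) /\ g (coords s) = coords t.
  by move=> Pt ->; exact: hP _ (coords_sum t) Pt.
have eE x t : e x.1.1 x.1.2 x.2 t = (coords t == x)%:R.
  by rewrite ffunE -!surjective_pairing.
case Qs: (Q (coords s)); last first.
  rewrite big1 // => t _; case: ifP => [Pt|]; rewrite ?eE ?ffunE //.
  by case: eqP => // /(h0 _ Pt) [] //; rewrite Qs.
have [Pg fg sg] := hQ _ (coords_sum s) Qs.
have [t et] := coords_exist sg.
have {}et : coords t = g (coords s) by rewrite et -!surjective_pairing.
rewrite (bigD1 t) //= et Pg fg eE eqxx big1 ?addr0 // => t' tt'.
case: ifP => [Pt|]; rewrite ?eE ?ffunE //.
case: eqP => // /(h0 _ Pt) [_]; rewrite -et => /coords_inj ett'.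
by rewrite ett' eqxx in tt'.
Qed.

Local Ltac shift := move=> [[? ?] ?] /= ? ?; split; try (congr (_, _, _)); lia.

Lemma pstar_basis_sum :
  \sum_(t : vtx n) pstar_basis (coords t).1.1 (coords t).1.2 (coords t).2 = 0.
Proof.
under eq_bigr do rewrite pstar_auxE /pstar_aux.
rewrite !big_split /= !sumrN.
have /= -> := @sum_shift
  (fun x => (0 < x.1.1) && (0 < x.2))%N
  (fun x => (0 < x.1.2) && (0 < x.2))%N
  (fun x => (x.1.1 - 1, x.1.2 + 1, x.2))%N
  (fun x => (x.1.1 + 1, x.1.2 - 1, x.2))%N
  ltac:(shift) ltac:(shift).
have /= -> := @sum_shift
  (fun x => (0 < x.1.1) && (x.2 == 0))%N
  (fun x => (0 < x.1.1) && (x.2 == 0))%N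
  (fun x => (x.1.1, x.1.2, x.2))%N
  (fun x => (x.1.1, x.1.2, x.2))%N
  ltac:(shift) ltac:(shift).
have /= -> := @sum_shift
  (fun x => (0 < x.1.1))%N
  (fun x => (0 < x.2))%N
  (fun x => (x.1.1 - 1, x.1.2, x.2 + 1))%N
  (fun x => (x.1.1 + 1, x.1.2, x.2 - 1))%N
  ltac:(shift) ltac:(shift).
have /= -> := @sum_shift
  (fun x => (0 < x.1.2) && (0 < x.1.1))%N
  (fun x => (0 < x.2) && (0 < x.1.1))%N
  (fun x => (x.1.1, x.1.2 - 1, x.2 + 1))%N
  (fun x => (x.1.1, x.1.2 + 1, x.2 - 1))%N
  ltac:(shift) ltac:(shift).
have /= -> := @sum_shift
  (fun x => (0 < x.1.2) && (x.1.1 == 0))%N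
  (fun x => (0 < x.1.2) && (x.1.1 == 0))%N
  (fun x => (x.1.1, x.1.2, x.2))%N
  (fun x => (x.1.1, x.1.2, x.2))%N
  ltac:(shift) ltac:(shift).
have /= -> := @sum_shift
  (fun x => (0 < x.1.2))%N
  (fun x => (0 < x.1.1))%N
  (fun x => (x.1.1 + 1, x.1.2 - 1, x.2))%N
  (fun x => (x.1.1 - 1, x.1.2 + 1, x.2))%N
  ltac:(shift) ltac:(shift).
have /= -> := @sum_shift
  (fun x => (0 < x.2) && (0 < x.1.2))%N
  (fun x => (0 < x.1.1) && (0 < x.1.2))%N
  (fun x => (x.1.1 + 1, x.1.2, x.2 - 1))%N
  (fun x => (x.1.1 - 1, x.1.2, x.2 + 1))%N
  ltac:(shift) ltac:(shift).
have /= -> := @sum_shift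
  (fun x => (0 < x.2) && (x.1.2 == 0))%N
  (fun x => (0 < x.2) && (x.1.2 == 0))%N
  (fun x => (x.1.1, x.1.2, x.2))%N
  (fun x => (x.1.1, x.1.2, x.2))%N
  ltac:(shift) ltac:(shift).
have /= -> := @sum_shift
  (fun x => (0 < x.2))%N
  (fun x => (0 < x.1.2))%N
  (fun x => (x.1.1, x.1.2 + 1, x.2 - 1))%N
  (fun x => (x.1.1, x.1.2 - 1, x.2 + 1))%N
  ltac:(shift) ltac:(shift).
apply/ffunP => s; rewrite !ffunE.
move: (nat_of_ord (sval s).1.1) (nat_of_ord (sval s).1.2).
by move: (nat_of_ord (sval s).2) => [|c] [|a] [|b] /=; ring.
Qed.

Lemma pstar_basis_sum_zero a b c : (a + b + c)%N = n ->
  pstar_basis a b c \in sum_zero.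
Proof.
pose tot (x : vec A n) : A := \sum_t x t.
have totD x y : tot (x + y) = tot x + tot y.
  by rewrite -big_split; apply: eq_bigr => t _; rewrite ffunE.
have totN x : tot (- x) = - tot x.
  by rewrite -sumrN; apply: eq_bigr => t _; rewrite ffunE.
have tot0 : tot 0 = 0 by rewrite /tot big1 // => t _; rewrite ffunE.
move=> abc; apply/eqP; change (tot (pstar_basis a b c) = 0).
rewrite /pstar_basis; case: a b c abc => [|a] [|b] [|c] /= abc //;
  by rewrite !(totD, totN) /tot !sum_bvec; [ring|lia..].
Qed.

Lemma pstar_vec_sum_zero x : pstar_vec x \in sum_zero.
Proof.
by apply: rpred_sum => t _; apply/rpredZ/pstar_basis_sum_zero/coords_sum.
Qed.

Lemma pstar_vec_is_linear : linear pstar_vec.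
Proof.
move=> a x y; rewrite /pstar_vec scaler_sumr -big_split; apply: eq_bigr => t _.
by rewrite !ffunE scalerDl -scalerA.
Qed.

HB.instance Definition _ :=
  GRing.isLinear.Build A (vec A n) (vec A n) _ pstar_vec pstar_vec_is_linear.

Lemma pstar_vec_const x : x \in const_line -> pstar_vec x = 0.
Proof.
move=> /const_lineP[c ->]; rewrite linearZ /= -[RHS](scaler0 _ c).
congr (_ *: _); rewrite -[RHS]pstar_basis_sum; apply: eq_bigr => t _.
by rewrite ffunE scale1r.
Qed.

Definition pstar (u : N) : M := MkM (pstar_vec_sum_zero (repr u)).

Lemma pstar_Ncls (x : vec A n) : pstar (Ncls x) = pstar_vec x :> vec A n.
Proof.
apply/eqP; rewrite -subr_eq0 /= -raddfB; apply/eqP/pstar_vec_const.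
by rewrite -Ncls_eq reprNK.
Qed.

Lemma pstar_is_linear : linear pstar.
Proof.
move=> a u v; rewrite -[u]reprNK -[v]reprNK -Ncls_is_linear; apply: val_inj.
have E z : val (pstar (Ncls z)) = pstar_vec z by exact: pstar_Ncls.
by rewrite E pstar_vec_is_linear -!E; exact/esym/(linearP (val : M -> vec A n)).
Qed.

HB.instance Definition _ :=
  GRing.isLinear.Build A N M _ pstar pstar_is_linear.

End Lattices.

Definition to_real (R : realType) n (x : vec int n) : vec R n :=
  [ffun t => (x t)%:~R].

(* As the classes of integral vectors span N R n, phiR is uniquely determined
   by phi. *)
Definition real_extension (R : realType) n (phi : {additive N int n -> M int n})
    (phiR : {linear N R n -> M R n}) : Prop :=
  forall x : vec int n,
    phiR (Ncls (to_real R x)) = to_real R (phi (Ncls x)) :> vec R n.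

Local Open Scope classical_set_scope.

Definition unimodularly_equivalent (R : realType) n
    (C : set (N R n)) (D : set (M R n)) : Prop :=
  exists (phi : {additive N int n -> M int n})
         (phiR : {linear N R n -> M R n}),
    [/\ bijective phi, real_extension phi phiR & phiR @` C = D].

Definition Xi (R : realType) n : set (M R n) :=
  [set g : M R n |
  [/\ forall a b i : nat, (0 < a)%N -> (0 < b)%N -> (a + b)%N = n ->
        (i <= b - 1)%N -> 0 <= \sum_(0 <= j < i.+1) entry g a (b - j) j,
      forall b c i : nat, (0 < b)%N -> (0 < c)%N -> (b + c)%N = n ->
        (i <= c - 1)%N -> 0 <= \sum_(0 <= j < i.+1) entry g j b (c - j)
    & forall a c i : nat, (0 < a)%N -> (0 < c)%N -> (a + c)%N = n ->
        (i <= a - 1)%N -> 0 <= \sum_(0 <= j < i.+1) entry g (a - j) j c]].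

Definition adjacent n (s t : vtx n) : bool :=
  let: (a, b, c) := coords s in
  let: (a', b', c') := coords t in
  perm_eq [:: a%:Z - a'%:Z; b%:Z - b'%:Z; c%:Z - c'%:Z] [:: 1; -1; 0].

Definition unit_triangle n (p q r : vtx n) : bool :=
  [&& adjacent p q, adjacent q r & adjacent p r].

(* Obtuse vertices p, q and acute vertices r, s. *)
Definition rhombus n (p q r s : vtx n) : bool :=
  [&& unit_triangle p q r, unit_triangle p q s & r != s].

Definition hives (R : realType) n : set (vec R n) :=
  [set x : vec R n |
  forall p q r s : vtx n, rhombus p q r s ->
    (x r : R) + x s <= (x p : R) + x q].

Definition hive_cone (R : realType) n : set (N R n) :=
  @Ncls R n @` @hives R n.

Arguments pstar A n : clear implicits.
Arguments Xi R n : clear implicits.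
Arguments hive_cone R n : clear implicits.

(* Main.v *)
Require Import Defs.
From HB Require Import structures.
From mathcomp Require Import all_boot all_order all_algebra.
From mathcomp Require Import zify ring lra.
From mathcomp Require Import boolp classical_sets reals.

Set Implicit Arguments.
Unset Strict Implicit.
Unset Printing Implicit Defensive.

Import Order.TTheory GRing.Theory Num.Theory.
Local Open Scope ring_scope.

(** The rhombus inequalities are linear forms in the labels, and the partial
    sums defining Xi, applied to the images [p*(e_t)], telescope to exactly these
    forms.  Hence the transpose of [p*] carries the hive cone onto Xi.  Both maps
    are isomorphisms: modulo the image of [p*] the telescoped relations make
    [t |-> e_t] affine on the triangle and the corner relations make it constant,
    so [p*] maps onto the vectors of sum 0; as [p*] kills 1, adding the corner's
    diagonal matrix unit to the matrix of [p*] then makes it surjective, hence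
    invertible, and this square matrix controls [p*] and its transpose alike. *)

(** * Bijections and one-sided inverses *)

Lemma inj_surj_bijective (S T : choiceType) (f : S -> T) :
  injective f -> (forall y, exists x, f x = y) -> bijective f.
Proof.
move=> finj fsurj.
have h y : exists x, f x == y by have [x <-] := fsurj y; exists x.
exists (fun y => xchoose (h y)) => [x|y]; last exact/eqP/(xchooseP (h y)).
exact/finj/eqP/(xchooseP (h (f x))).
Qed.

(** Enumerating [I] turns [f] and [g] into square matrices over a commutative ring, where a
    one-sided inverse is two-sided. *)
Lemma sum_mul1C (A : comNzRingType) (I : finType) (f g : I -> I -> A) :
    (forall i k, \sum_j f i j * g j k = (i == k)%:R) ->
  forall i k, \sum_j g i j * f j k = (i == k)%:R.
Proof.
move=> fg i k.
pose F := \matrix_(u < #|I|, v < #|I|) f (enum_val u) (enum_val v).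
pose G := \matrix_(u < #|I|, v < #|I|) g (enum_val u) (enum_val v).
have /mulmx1C/matrixP/(_ (enum_rank i) (enum_rank k)) : F *m G = 1%:M.
  apply/matrixP => u v; rewrite !mxE -(inj_eq enum_val_inj) -fg.
  rewrite [RHS](reindex (@enum_val I predT)) /=; last exact/onW_bij/enum_val_bij.
  by apply: eq_bigr => j _; rewrite !mxE.
rewrite !mxE (inj_eq enum_rank_inj) => <-.
rewrite [LHS](reindex (@enum_val I predT)) /=; last exact/onW_bij/enum_val_bij.
by apply: eq_bigr => j _; rewrite !mxE !enum_rankK.
Qed.

(** * Hexagon and rhombus forms *)

Section Hexagons.
Variable V : zmodType.
Implicit Types F : nat -> nat -> nat -> V.

(** The shape of [pstar_basis] for an arbitrary family [F] in place of the basis vectors, so that it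
    can also be applied to [rot F]. *)
Definition hex F (a b c : nat) : V :=
  match a, b, c with
  | S a', S b', S c' => F a' b.+1 c + F a b' c.+1 + F a.+1 b c'
      - F a.+1 b' c - F a b.+1 c' - F a' b c.+1
  | S a', S b', O => F a b 0 - F a' b 1 + F a b' 1 - F a.+1 b' 0
  | O, S b', S c' => F 0 b c - F 1 b' c + F 1 b c' - F 0 b.+1 c'
  | S a', O, S c' => F a 0 c - F a 1 c' + F a' 1 c - F a' 0 c.+1
  | S a', O, O => F a 0 0 - F a' 0 1
  | O, S b', O => F 0 b 0 - F 1 b' 0
  | O, O, S c' => F 0 0 c - F 0 1 c'
  | O, O, O => 0
  end.

(* Obtuse minus acute vertices, for the rhombus whose shared edge joins
   (a + 1, b + 1, c) and (a + 1, b, c + 1). *)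
Definition rho F (a b c : nat) : V :=
  F a.+1 b.+1 c + F a.+1 b c.+1 - F a.+2 b c - F a b.+1 c.+1.

(** Rotates the triangle: [rho] of [rot F] and of [rot (rot F)] are the rhombus forms of the other
    two orientations. *)
Definition rot F (a b c : nat) : V := F c a b.

End Hexagons.

Section Pairing.
Variables (A : comNzRingType) (n : nat).
Implicit Types (x y : vec A n) (F : nat -> nat -> nat -> vec A n).

Lemma hex_rot F a b c : hex F a b c = hex (rot F) b c a.
Proof.
by case: a b c => [|a] [|b] [|c] //=; apply/ffunP => t; rewrite !ffunE;
  rewrite /rot; ring.
Qed.

(** The boundary term [j = 0] is itself a rhombus form, and each interior hexagon is the difference
    of two neighbouring ones, so the sum telescopes along the line of constant first coordinate. *)
Lemma hex_sum F a k i :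
  \sum_(0 <= j < i.+1) hex F a.+1 (k.+1 + i - j) j = rho F a k i.
Proof.
elim: i k => [|i IH] k.
  rewrite big_nat1 addn0 subn0 /= /rho.
  by apply/ffunP => t; rewrite !ffunE; ring.
have -> : (k.+1 + i.+1 = k.+2 + i)%N by lia.
rewrite big_nat_recr // IH addSnnS addnK /= /rho.
by apply/ffunP => t; rewrite !ffunE; ring.
Qed.

Lemma pstar_basisE a b c : pstar_basis A n a b c = hex (bvec A n) a b c.
Proof.
by case: a b c => [|a] [|b] [|c] //=; rewrite /pstar_basis /= ?subn1 ?addn1.
Qed.

(** * Congruences forced by the hexagon relations *)

Section Congruence.
Variable I : vec A n -> Prop.
Hypotheses (I0 : I 0) (IB : forall x y, I x -> I y -> I (x - y)).

Let IN x : I x -> I (- x).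
Proof. by move=> Ix; rewrite -sub0r; apply: IB. Qed.

Let ID x y : I x -> I y -> I (x + y).
Proof. by move=> Ix Iy; rewrite -[y]opprK; apply/IB/IN. Qed.

Lemma rho_cong F : (forall a b c, (a + b + c = n)%N -> I (hex F a b c)) ->
  forall a b c, (a + b + c).+2 = n -> I (rho F a b c).
Proof.
move=> Ihex a b c abc; rewrite -hex_sum big_nat_cond.
apply: (big_ind I) => // j; rewrite andbT => /andP[_ jc]; apply: Ihex; lia.
Qed.

(** A rhombus relation identifies the differences of [F] along two parallel sides. The corner (n, 0,
    0) gives the first difference, which is carried to the edges starting on the side c = 0, then
    inwards. *)
Lemma edge_cong F : (forall a b c, (a + b + c = n)%N -> I (hex F a b c)) ->
  forall a b c, (a + b + c).+1 = n -> I (F a.+1 b c - F a b c.+1).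
Proof.
move=> Ihex a b c; elim: c b => [|c IHc] b.
  elim: b a => [|b IHb] a abc.
    by have := Ihex a.+1 0 0; rewrite /=; apply; lia.
  have h1 : I (rho F a b 0) by apply: rho_cong => //; lia.
  have := ID h1 (IHb a.+1 ltac:(lia)); congr I.
  by apply/ffunP => t; rewrite !ffunE; ring.
move=> abc; have h2 : I (rho (rot (rot F)) c a b).
  apply: rho_cong => [a' b' c' e'|]; last by lia.
  by have := Ihex b' c' a'; rewrite 2!hex_rot; apply; lia.
have := ID h2 (IHc b.+1 ltac:(lia)); congr I.
by apply/ffunP => t; rewrite !ffunE /rot; ring.
Qed.

(* Modulo [I], the rhombus relations make [F] affine and the corner relations
   make its linear part vanish. *)
Lemma vertex_cong F : (forall a b c, (a + b + c = n)%N -> I (hex F a b c)) ->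
  forall a b c, (a + b + c = n)%N -> I (F a b c - F n 0 0).
Proof.
move=> Ihex a b c; elim: c a => [|c IHc] a.
  elim: b a => [|b IHb] a abc.
    by have -> : a = n by [lia]; rewrite subrr.
  (* In rotated coordinates this is an edge difference, now propagated from the corner (0, n, 0). *)
  have h : I (F a b.+1 0 - F a.+1 b 0).
    have Ihex' a' b' c' : (a' + b' + c' = n)%N -> I (hex (rot F) a' b' c').
      by move=> e'; rewrite -hex_rot; apply: Ihex; lia.
    by have := @edge_cong _ Ihex' b 0 a; rewrite /rot; apply; lia.
  by have := ID h (IHb a.+1 ltac:(lia)); rewrite addrA subrK.
move=> abc; have h := @edge_cong _ Ihex a b c ltac:(lia).
by have := IB (IHc a.+1 ltac:(lia)) h; rewrite opprB addrC addrA subrK.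
Qed.

End Congruence.

(** * The pairing and the transpose of p* *)

Definition pairing x y : A^o := \sum_t (x t : A) * y t.

Lemma pairing_is_linear x : linear (pairing x).
Proof.
move=> a y z; rewrite /pairing scaler_sumr -big_split; apply: eq_bigr => t _.
by rewrite !ffunE mulrDr; congr (_ + _); exact: mulrCA.
Qed.

HB.instance Definition _ x :=
  GRing.isLinear.Build A (vec A n) A^o _ (pairing x) (pairing_is_linear x).

Lemma pairing_bvec x a b c : pairing x (bvec A n a b c) = entry x a b c.
Proof.
rewrite /entry [RHS]big_mkcond; apply: eq_bigr => t _.
by rewrite ffunE; case: eqP => _; rewrite ?mulr1 ?mulr0.
Qed.

Lemma entryE x (t : vtx n) :
  entry x (coords t).1.1 (coords t).1.2 (coords t).2 = x t.
Proof. by rewrite /entry (big_pred1 t). Qed.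

Lemma pairingC x y : pairing x y = pairing y x.
Proof. by apply: eq_bigr => t _; exact: mulrC. Qed.

Definition tpstar_vec x : vec A n :=
  [ffun t => pairing x
     (pstar_basis A n (coords t).1.1 (coords t).1.2 (coords t).2)].

Lemma tpstar_vec_entry x a b c : (a + b + c = n)%N ->
  entry (tpstar_vec x) a b c = pairing x (pstar_basis A n a b c).
Proof.
move=> /coords_exist[t et].
by have := entryE (tpstar_vec x) t; rewrite ffunE et.
Qed.

(** Transposition exchanges two properties: p* killing 1 gives sum 0 here, and the image of p*
    having sum 0 makes the transpose kill 1. *)
Lemma tpstar_vec_sum_zero x : tpstar_vec x \in @sum_zero A n.
Proof.
apply/eqP; under eq_bigr do rewrite ffunE.
by rewrite -raddf_sum pstar_basis_sum raddf0.
Qed.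

Lemma tpstar_vec_is_linear : linear tpstar_vec.
Proof.
move=> a x y; apply/ffunP => t; rewrite !ffunE.
rewrite ![pairing _ (pstar_basis _ _ _ _ _)]pairingC.
exact: linearP.
Qed.

HB.instance Definition _ :=
  GRing.isLinear.Build A (vec A n) (vec A n) _ tpstar_vec tpstar_vec_is_linear.

Lemma tpstar_vec_const x : x \in @const_line A n -> tpstar_vec x = 0.
Proof.
move=> /const_lineP[c ->]; apply/ffunP => t; rewrite !ffunE pairingC linearZ /=.
rewrite /pairing; under eq_bigr do rewrite ffunE mulr1.
have /eqP -> := pstar_basis_sum_zero A (coords_sum t).
exact: mulr0.
Qed.

Definition tpstar (u : N A n) : M A n := MkM (tpstar_vec_sum_zero (repr u)).

Lemma tpstar_Ncls x : tpstar (Ncls x) = tpstar_vec x :> vec A n.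
Proof.
apply/eqP; rewrite -subr_eq0 /= -raddfB; apply/eqP/tpstar_vec_const.
by rewrite -Ncls_eq reprNK.
Qed.

Lemma tpstar_is_linear : linear tpstar.
Proof.
move=> a u v; rewrite -[u]reprNK -[v]reprNK -Ncls_is_linear; apply: val_inj.
have E z : val (tpstar (Ncls z)) = tpstar_vec z by exact: tpstar_Ncls.
by rewrite E tpstar_vec_is_linear -!E; exact/esym/(linearP (val : M A n -> vec A n)).
Qed.

HB.instance Definition _ :=
  GRing.isLinear.Build A (N A n) (M A n) _ tpstar tpstar_is_linear.

(** * Surjectivity of p* and bijectivity of both maps *)

Lemma bvec_coords (t s : vtx n) :
  bvec A n (coords t).1.1 (coords t).1.2 (coords t).2 s = (s == t)%:R.
Proof. by rewrite ffunE -!surjective_pairing (inj_eq (@coords_inj n)). Qed.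

Lemma vec_sum x :
  x = \sum_t x t *: bvec A n (coords t).1.1 (coords t).1.2 (coords t).2.
Proof.
apply/ffunP => s; rewrite sum_ffunE (bigD1 s) // big1 => [|t ts].
  by rewrite ffunE bvec_coords eqxx -[LHS]mulr1; exact/esym/addr0.
by rewrite ffunE bvec_coords eq_sym (negPf ts); exact: scaler0.
Qed.

Lemma pstar_vec_bvec a b c : (a + b + c = n)%N ->
  pstar_vec (bvec A n a b c) = pstar_basis A n a b c.
Proof.
move=> /coords_exist[t et].
rewrite /pstar_vec (bigD1 t) // big1 => [|s st].
  by rewrite ffunE et eqxx scale1r; exact: addr0.
by rewrite ffunE -et (inj_eq (@coords_inj n)) (negPf st) scale0r.
Qed.

(** By [vertex_cong], all basis vectors agree modulo the image of p*, and a vector of sum 0 is a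
    combination of their differences. *)
Lemma pstar_vec_surj x : x \in @sum_zero A n -> exists y, pstar_vec y = x.
Proof.
move=> /eqP x0; pose I x := exists y, pstar_vec y = x.
have IB y z : I y -> I z -> I (y - z).
  by move=> [y' <-] [z' <-]; exists (y' - z'); rewrite raddfB.
have I0 : I 0 by exists 0; rewrite raddf0.
have Ie a b c : (a + b + c = n)%N -> I (bvec A n a b c - bvec A n n 0 0).
  apply: vertex_cong => // {}a {}b {}c abc; rewrite -pstar_basisE.
  by exists (bvec A n a b c); exact: pstar_vec_bvec.
rewrite -/(I x).
have -> : x = \sum_t x t *: (bvec A n (coords t).1.1 (coords t).1.2 (coords t).2
                           - bvec A n n 0 0).
  under eq_bigr do rewrite scalerBr.
  by rewrite sumrB -vec_sum -scaler_suml x0 scale0r subr0.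
apply: (big_ind I) => // [y z Iy Iz|t _].
  by rewrite -[z]opprK -[- z]sub0r; exact: (IB _ _ Iy (IB _ _ I0 Iz)).
have [y <-] := Ie _ _ _ (coords_sum t); exists (x t *: y); exact: linearZ.
Qed.

(** Up to the corner term, row [t] is p*(e_t): row vectors multiplied by it see p*, column vectors
    its transpose. *)
Definition pstar_kernel (t s : vtx n) : A :=
  (pstar_basis A n (coords t).1.1 (coords t).1.2 (coords t).2 s : A)
  + ((t == corner n) && (s == corner n))%:R.

Lemma pstar_kernel_suml x s : \sum_t (x t : A) * pstar_kernel t s
  = (pstar_vec x s : A) + x (corner n) * (s == corner n)%:R.
Proof.
under eq_bigr do rewrite mulrDr.
rewrite big_split /= /pstar_vec sum_ffunE; congr (_ + _).
  by apply: eq_bigr => t _; rewrite [RHS]ffunE.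
rewrite (bigD1 (corner n)) //= eqxx big1 ?addr0 // => t /negPf ->.
exact: mulr0.
Qed.

Lemma pstar_kernel_sumr x t : \sum_s pstar_kernel t s * x s
  = (tpstar_vec x t : A) + (t == corner n)%:R * x (corner n).
Proof.
under eq_bigr do rewrite mulrDl.
rewrite big_split /= ffunE; congr (_ + _).
  by apply: eq_bigr => s _; exact: mulrC.
rewrite (bigD1 (corner n)) //= eqxx andbT big1 ?addr0 // => s /negPf ->.
by rewrite andbF mul0r.
Qed.

Lemma pstar_kernel_inv : exists b : vtx n -> vtx n -> A,
  (forall u s, \sum_t b u t * pstar_kernel t s = (u == s)%:R) /\
  (forall t s, \sum_u pstar_kernel t u * b u s = (t == s)%:R).
Proof.
have h u : exists z : vec A n,
    forall s, \sum_t (z t : A) * pstar_kernel t s = (u == s)%:R.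
  pose d : vec A n := [ffun s => (u == s)%:R - (s == corner n)%:R].
  have [|y yd] := @pstar_vec_surj d.
    apply/eqP; under eq_bigr do rewrite ffunE.
    rewrite sumrB (bigD1 u) //= (bigD1 (corner n) (P := predT)) //= !eqxx.
    rewrite !big1 ?addr0 ?subrr // => s; last by rewrite eq_sym => /negPf ->.
    by move=> /negPf ->.
  (* The constant vector leaves the image under p* unchanged and makes the corner entry 1, so the
     corner term restores what [d] subtracts. *)
  exists (y + (1 - y (corner n)) *: [ffun=> 1]) => s.
  rewrite pstar_kernel_suml raddfD /= (@pstar_vec_const _ _ (_ *: _)); last first.
    by apply/const_lineP; exists (1 - y (corner n)).
  rewrite addr0 yd !ffunE.
  have -> : (1 - y (corner n)) *: (1 : A^o) = 1 - y (corner n) by exact: mulr1.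
  by rewrite addrCA subrr addr0 mul1r subrK.
have [b hb] := choice h.
exists b; split=> //; exact: (sum_mul1C (f := fun u t => b u t)).
Qed.

(** On such representatives the corner term of [pstar_kernel] vanishes, so invertibility of that
    matrix gives injectivity on [N]. *)
Lemma vec_normal (u : N A n) :
  exists2 x : vec A n, Ncls x = u & x (corner n) = 0.
Proof.
exists (repr u - repr u (corner n) *: [ffun=> 1]); last first.
  by rewrite !ffunE [X in _ - X]mulr1 subrr.
apply/eqP; rewrite -[eqbRHS]reprNK Ncls_eq addrAC subrr sub0r rpredN.
by apply/const_lineP; eexists.
Qed.

Lemma pstar_bij : bijective (pstar A n).
Proof.
apply: inj_surj_bijective => [|y]; last first.
  have [x xy] := pstar_vec_surj (MvalP y).
  by exists (Ncls x); apply: val_inj; exact: etrans (pstar_Ncls x) xy.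
have [b [_ hb]] := pstar_kernel_inv.
apply: raddf_inj => u; have [x <- x0] := vec_normal u.
move=> ux0; have px : pstar_vec x = 0 by rewrite -pstar_Ncls ux0.
suff -> : x = 0 by rewrite raddf0.
apply/ffunP => t; rewrite ffunE.
(* Inserts the matrix times its inverse [b]; the inner sum is then 0 by [px] and [x0]. *)
transitivity (\sum_u (\sum_s (x s : A) * pstar_kernel s u) * b u t).
  under eq_bigr do rewrite mulr_suml.
  rewrite exchange_big (bigD1 t) //=.
  under eq_bigr do rewrite -mulrA.
  rewrite -mulr_sumr hb eqxx mulr1 big1 ?addr0 // => s st.
  under eq_bigr do rewrite -mulrA.
  by rewrite -mulr_sumr hb (negPf st) mulr0.
rewrite big1 // => s _; rewrite pstar_kernel_suml px x0 ffunE.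
by rewrite mul0r addr0 mul0r.
Qed.

Lemma tpstar_bij : bijective tpstar.
Proof.
have [b [hl hr]] := pstar_kernel_inv.
apply: inj_surj_bijective => [|y]; last first.
  pose x : vec A n := [ffun s => \sum_u b s u * Mval y u].
  have xE t : (tpstar_vec x t : A) + (t == corner n)%:R * x (corner n) = Mval y t.
    rewrite -pstar_kernel_sumr.
    under eq_bigr do rewrite ffunE mulr_sumr.
    rewrite exchange_big (bigD1 t) //=.
    under eq_bigr do rewrite mulrA.
    rewrite -mulr_suml hr eqxx mul1r big1 ?addr0 // => s st.
    under eq_bigr do rewrite mulrA.
    by rewrite -mulr_suml hr eq_sym (negPf st) mul0r.
  (* Summing [xE] over all entries kills both the transpose and [y], leaving the corner entry of
     [x]. *)
  have x0 : x (corner n) = 0.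
    have /eqP : \sum_t Mval y t = 0 by apply/eqP/(MvalP y).
    under eq_bigr do rewrite -xE.
    rewrite big_split /= (eqP (tpstar_vec_sum_zero x)) add0r -mulr_suml.
    rewrite (bigD1 (corner n)) //= eqxx big1 ?addr0 ?mul1r => [/eqP //|t].
    by move=> /negPf ->.
  exists (Ncls x); apply/val_inj/ffunP => t.
  by rewrite -xE x0 mulr0 addr0 -tpstar_Ncls.
apply: raddf_inj => u; have [x <- x0] := vec_normal u.
move=> ux0; have px : tpstar_vec x = 0 by rewrite -tpstar_Ncls ux0.
suff -> : x = 0 by rewrite raddf0.
apply/ffunP => t; rewrite ffunE.
transitivity (\sum_s b t s * (\sum_u pstar_kernel s u * x u)).
  under eq_bigr do rewrite mulr_sumr.
  rewrite exchange_big (bigD1 t) //=.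
  under eq_bigr do rewrite mulrA.
  rewrite -mulr_suml hl eqxx mul1r big1 ?addr0 // => s st.
  under eq_bigr do rewrite mulrA.
  by rewrite -mulr_suml hl eq_sym (negPf st) mul0r.
rewrite big1 // => s _; rewrite pstar_kernel_sumr px x0 ffunE.
by rewrite mulr0 addr0 mulr0.
Qed.

End Pairing.

(** * Partial sums in Xi as rhombus forms *)

Lemma pairing_rho (A : comNzRingType) n (x : vec A n) F a b c :
  pairing x (rho F a b c) = rho (fun a b c => pairing x (F a b c)) a b c.
Proof. by rewrite !raddfB raddfD. Qed.

Definition rho_ge0 (R : realType) n (F : nat -> nat -> nat -> R) : Prop :=
  forall a b c, (a + b + c).+2 = n -> 0 <= rho F a b c.

Definition hive_ineqs (R : realType) n (x : vec R n) : Prop :=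
  let F : nat -> nat -> nat -> R := entry x in
  [/\ rho_ge0 n F, rho_ge0 n (rot F) & rho_ge0 n (rot (rot F))].

Lemma sum_pairing_hex (R : realType) n (x : vec R n)
    (F : nat -> nat -> nat -> vec R n) (s : nat -> R) a k i :
    (forall j, (j <= i)%N -> s j = pairing x (hex F a.+1 (k.+1 + i - j) j)) ->
  \sum_(0 <= j < i.+1) s j = rho (fun a b c => pairing x (F a b c) : R) a k i.
Proof.
move=> sE; rewrite -pairing_rho -hex_sum raddf_sum; apply: eq_big_nat => j /andP[_].
exact: sE.
Qed.

(** Each partial sum pairs [x] with a telescoping sum of hexagons; the three families of
    inequalities give the three orientations of rhombi. *)
Lemma tpstar_Xi (R : realType) n (x : vec R n) :
  Xi R n (tpstar (Ncls x)) <-> hive_ineqs x.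
Proof.
have eE : entry x = fun a b c => pairing x (bvec R n a b c).
  by apply/funext => a; apply/funext => b; apply/funext => c; rewrite pairing_bvec.
have sum1 a k i : (a + k + i).+2 = n ->
    \sum_(0 <= j < i.+1) entry (tpstar (Ncls x)) a.+1 (k.+1 + i - j) j
    = rho (entry x : _ -> _ -> _ -> R) a k i.
  move=> e; rewrite eE; apply: sum_pairing_hex => j ji.
  by rewrite tpstar_Ncls tpstar_vec_entry ?pstar_basisE //; lia.
have sum2 a k i : (a + k + i).+2 = n ->
    \sum_(0 <= j < i.+1) entry (tpstar (Ncls x)) j a.+1 (k.+1 + i - j)
    = rho (rot (entry x : _ -> _ -> _ -> R)) a k i.
  move=> e; rewrite eE; apply: (@sum_pairing_hex _ _ _ (rot (bvec R n))) => j ji.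
  by rewrite tpstar_Ncls tpstar_vec_entry ?pstar_basisE ?(hex_rot _ j) //; lia.
have sum3 a k i : (a + k + i).+2 = n ->
    \sum_(0 <= j < i.+1) entry (tpstar (Ncls x)) (k.+1 + i - j) j a.+1
    = rho (rot (rot (entry x : _ -> _ -> _ -> R))) a k i.
  move=> e; rewrite eE; apply: (@sum_pairing_hex _ _ _ (rot (rot (bvec R n)))) => j ji.
  rewrite tpstar_Ncls tpstar_vec_entry ?pstar_basisE; last by lia.
  by rewrite (hex_rot _ (_ - j)) (hex_rot _ j).
split=> -[h1 h2 h3]; split=> [a b c|a b c|a b c].
- by move=> e; rewrite -sum1 //; apply: h1; lia.
- by move=> e; rewrite -sum2 //; apply: h2; lia.
- by move=> e; rewrite -sum3 //; apply: h3; lia.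
(* Here [c] is the bound i of the partial sum, and k = b - i - 1 puts the sum in the form of
   [sum1]. *)
- case: a => // a _ b0 e cb; have -> : b = ((b - c.+1).+1 + c)%N by lia.
  by rewrite sum1; [apply: h1|]; lia.
- case: a => // a _ b0 e cb; have -> : b = ((b - c.+1).+1 + c)%N by lia.
  by rewrite sum2; [apply: h2|]; lia.
- move=> a0; case: b => // b _ e cb; have -> : a = ((a - c.+1).+1 + c)%N by lia.
  by rewrite sum3; [apply: h3|]; lia.
Qed.

(** * Adjacency and rhombi in coordinates *)

Definition nadj (a b c a' b' c' : nat) : bool :=
  [&& (a, b, c) != (a', b', c'), a <= a'.+1, a' <= a.+1,
    b <= b'.+1, b' <= b.+1, c <= c'.+1 & c' <= c.+1]%N.

Lemma nadj_rot a b c a' b' c' : nadj a b c a' b' c' = nadj b c a b' c' a'.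
Proof. by rewrite /nadj !xpair_eqE; apply/idP/idP; lia. Qed.

(** Makes the shared edge determine the rhombus: distinct acute vertices lie on opposite sides. The
    form [a.+1 = u] rules out the second side when the edge lies on the boundary u = 0. *)
Lemma nadj_common u v w a b c : (a + b + c = (u + v + w).+1)%N ->
    nadj u v.+1 w a b c -> nadj u v w.+1 a b c ->
  [/\ a = u.+1, b = v & c = w] \/ [/\ a.+1 = u, b = v.+1 & c = w.+1].
Proof.
rewrite /nadj !xpair_eqE => e /and4P[n1 h1 h2 h3] /and4P[n2 _ _ h4].
by case: (ltngtP a u) => au; [right|left|]; [split..|]; lia.
Qed.

Lemma nadj_edge a b c a' b' c' : (a + b + c = a' + b' + c')%N ->
    nadj a b c a' b' c' ->
  [\/ [/\ a = a', b = b'.+1 & c' = c.+1] \/ [/\ a' = a, b' = b.+1 & c = c'.+1],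
      [/\ b = b', c = c'.+1 & a' = a.+1] \/ [/\ b' = b, c' = c.+1 & a = a'.+1]
    | [/\ c = c', a = a'.+1 & b' = b.+1] \/ [/\ c' = c, a' = a.+1 & b = b'.+1]].
Proof.
rewrite /nadj !xpair_eqE => e /and4P[n1 h1 h2 h3].
case: (ltngtP a a') => aa; case: (ltngtP b b') => bb; case: (ltngtP c c') => cc;
  try (exfalso; lia).
all: first [apply: Or31; (left + right); by split; lia
  | apply: Or32; (left + right); by split; lia
  | apply: Or33; (left + right); by split; lia].
Qed.

Lemma rho_ge0_rhombus (R : realType) n (G : nat -> nat -> nat -> R)
    u v w v' w' a b c a' b' c' :
    rho_ge0 n G -> v = v'.+1 -> w' = w.+1 -> (u + v + w = n)%N ->
    (a + b + c = n)%N -> (a' + b' + c' = n)%N -> (a, b, c) != (a', b', c') ->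
    nadj u v w a b c -> nadj u v' w' a b c ->
    nadj u v w a' b' c' -> nadj u v' w' a' b' c' ->
  G a b c + G a' b' c' <= G u v w + G u v' w'.
Proof.
move=> hG -> -> s s1 s2 neq n1 n2 n3 n4.
have e1 : (a + b + c = (u + v' + w).+1)%N by lia.
have e2 : (a' + b' + c' = (u + v' + w).+1)%N by lia.
have [[ea eb ec]|[ea eb ec]] := nadj_common e1 n1 n2;
  have [[ea' eb' ec']|[ea' eb' ec']] := nadj_common e2 n3 n4.
- by move: neq; rewrite ea eb ec ea' eb' ec' eqxx.
- have := hG a' v' w ltac:(lia); rewrite /rho ea eb ec eb' ec' -ea'; lra.
- have := hG a v' w ltac:(lia); rewrite /rho ea' eb' ec' eb ec -ea; lra.
- by move: neq; rewrite eb ec eb' ec'; move: ea; rewrite -ea' => -[->]; rewrite eqxx.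
Qed.

Lemma rho_ge0_edge (R : realType) n (G : nat -> nat -> nat -> R)
    a1 b1 c1 a2 b2 c2 a3 b3 c3 a4 b4 c4 :
    rho_ge0 n G -> (a1 + b1 + c1 = n)%N -> (a2 + b2 + c2 = n)%N ->
    (a3 + b3 + c3 = n)%N -> (a4 + b4 + c4 = n)%N -> (a3, b3, c3) != (a4, b4, c4) ->
    nadj a1 b1 c1 a3 b3 c3 -> nadj a2 b2 c2 a3 b3 c3 ->
    nadj a1 b1 c1 a4 b4 c4 -> nadj a2 b2 c2 a4 b4 c4 ->
    [/\ a1 = a2, b1 = b2.+1 & c2 = c1.+1] \/ [/\ a2 = a1, b2 = b1.+1 & c1 = c2.+1] ->
  G a3 b3 c3 + G a4 b4 c4 <= G a1 b1 c1 + G a2 b2 c2.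
Proof.
move=> hG s1 s2 s3 s4 neq n1 n2 n3 n4 [] [ea eb ec].
  by subst a1; apply: (rho_ge0_rhombus hG).
by subst a2; rewrite [leRHS]addrC; apply: (rho_ge0_rhombus hG).
Qed.

(** Between triples of equal sum, a nonzero difference with entries in {-1, 0, 1} must be a
    permutation of (1, -1, 0). *)
Lemma adjacentP n (s t : vtx n) (a := (coords s).1.1) (b := (coords s).1.2)
    (c := (coords s).2) (a' := (coords t).1.1) (b' := (coords t).1.2)
    (c' := (coords t).2) :
  adjacent s t = nadj a b c a' b' c'.
Proof.
rewrite /adjacent -/a -/b -/c -/a' -/b' -/c'.
rewrite (surjective_pairing (coords s)) (surjective_pairing (coords s).1).
rewrite (surjective_pairing (coords t)) (surjective_pairing (coords t).1).
rewrite -/a -/b -/c -/a' -/b' -/c' -mem_permutations.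
(* Expanding the permutations into an explicit list leaves pure linear arithmetic. *)
pose E := permutations [:: 1; -1; 0 : int].
rewrite /nadj -/E; vm_compute in E; rewrite /E !inE !eqseq_cons !andbT !xpair_eqE.
move: (coords_sum s) (coords_sum t).
rewrite -/a -/b -/c -/a' -/b' -/c'; clearbody a b c a' b' c'; lia.
Qed.

Lemma hivesP (R : realType) n (x : vec R n) : hives x <-> hive_ineqs x.
Proof.
pose F : nat -> nat -> nat -> R := entry x.
have xE (t : vtx n) : x t = F (coords t).1.1 (coords t).1.2 (coords t).2.
  by rewrite /F entryE.
split=> [h|[h1 h2 h3] p q r s].
  have hF a1 b1 c1 a2 b2 c2 a3 b3 c3 a4 b4 c4 :
      (forall p q r s : vtx n, coords p = (a1, b1, c1) -> coords q = (a2, b2, c2) ->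
        coords r = (a3, b3, c3) -> coords s = (a4, b4, c4) -> rhombus p q r s) ->
      (a1 + b1 + c1 = n)%N -> (a2 + b2 + c2 = n)%N ->
      (a3 + b3 + c3 = n)%N -> (a4 + b4 + c4 = n)%N ->
      0 <= F a1 b1 c1 + F a2 b2 c2 - F a3 b3 c3 - F a4 b4 c4.
    move=> hr /coords_exist[p ep] /coords_exist[q eq] /coords_exist[r er].
    move=> /coords_exist[s es]; have := h _ _ _ _ (hr p q r s ep eq er es).
    by rewrite !xE ep eq er es /=; lra.
  split=> a b c e; rewrite /rho /rot; apply: hF; try lia;
    move=> p q r s ep eq er es; rewrite /rhombus /unit_triangle !adjacentP;
    rewrite -(inj_eq (@coords_inj n)) ep eq er es /nadj /= !xpair_eqE; lia.
move: (coords_sum p) (coords_sum q) (coords_sum r) (coords_sum s).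
rewrite /rhombus /unit_triangle !adjacentP -(inj_eq (@coords_inj n)) !xE.
case: (coords p) => [[a1 b1] c1]; case: (coords q) => [[a2 b2] c2].
case: (coords r) => [[a3 b3] c3]; case: (coords s) => [[a4 b4] c4] /=.
move=> e1 e2 e3 e4 /and3P[/and3P[pq qr pr] /and3P[_ qs ps] rs].
have sum_rot a b c : (a + b + c)%N = n -> (b + c + a)%N = n.
  by move=> <-; rewrite addnC addnA.
have pair_rot (a b c a' b' c' : nat) : (a, b, c) != (a', b', c') ->
    (b, c, a) != (b', c', a').
  by rewrite !xpair_eqE -andbA andbC.
(* The coordinate constant along the shared edge gives the orientation; the last two cases are
   rotated into the first. *)
have [pq1|pq2|pq3] := nadj_edge (etrans e1 (esym e2)) pq.
- exact: (rho_ge0_edge h1).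
- apply: (@rho_ge0_edge _ _ _ b1 c1 a1 b2 c2 a2 b3 c3 a3 b4 c4 a4 h2) => //;
    try exact: sum_rot; try exact: pair_rot; by rewrite -nadj_rot.
- apply: (@rho_ge0_edge _ _ _ c1 a1 b1 c2 a2 b2 c3 a3 b3 c4 a4 b4 h3) => //;
    try exact/sum_rot/sum_rot; try exact/pair_rot/pair_rot; by rewrite -2!nadj_rot.
Qed.


(** * Integrality and the equivalence of cones *)

Lemma pstar_basis_intr (A : comNzRingType) n a b c (s : vtx n) :
  pstar_basis A n a b c s = (pstar_basis int n a b c s : int)%:~R.
Proof.
rewrite !pstar_basisE; case: a b c => [|a] [|b] [|c]; rewrite /= !ffunE //.
all: by rewrite ?(rmorphB, rmorphD, rmorphN, rmorph_nat) /=.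
Qed.

Theorem proposition24 (R : realType) (n : nat) (hn : (1 <= n)%N) :
  bijective (pstar int n : {linear N int n -> M int n}) /\
  unimodularly_equivalent (hive_cone R n) (Xi R n).
Proof.
split; first exact: pstar_bij.
(* The equivalence is the transpose of p*, given by one integer matrix over both rings. *)
exists (@tpstar int n), (@tpstar R n); split.
- exact: tpstar_bij.
- move=> x; rewrite !tpstar_Ncls; apply/ffunP => t; rewrite !ffunE.
  rewrite /pairing rmorph_sum; apply: eq_bigr => s _.
  rewrite [RHS]rmorphM ffunE; congr (_ * _).
  exact: pstar_basis_intr.
apply/seteqP; split=> [_ [_ [x hx <-] <-]|g gX].
  exact: (tpstar_Xi x).2 ((hivesP x).1 hx).
have [f _ fK] := tpstar_bij R n.
exists (f g); last exact: fK.
exists (repr (f g)); last exact: reprNK.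
by apply: (hivesP _).2 ((tpstar_Xi _).1 _); rewrite reprNK fK.
Qed.
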